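(* Let $(X_1,Y_1),(X_2,Y_2),\dots$ be i.i.d. random pairs with values in $\mathcal{X}\times\mathcal{Y}$, and let $(X_{\rm test},Y_{\rm test})$ be a further pair with the same distribution, independent of them. For each $n$, the calibration set is $\{(X_i,Y_i)\}_{i=1}^n$. Let $\alpha\in(0,1)$ be a fixed constant, and let $S:\mathcal{X}\times\mathcal{Y}\to\mathbb{R}$ be a fixed score function. Assume that one of the following two cases holds. (i) (Classification, sigmoid smoothing) $\mathcal{Y}$ is a finite set, $S$ takes values in $[S_{\min},S_{\max}]$ with $0<S_{\min}\le S_{\max}<\infty$, $n>S_{\max}/S_{\min}$, and for some fixed $k>0$ the sizes are the sigmoid-smoothed sizes $$\mathrm{Size}\big(\hat C_n^{\alpha}(X_{\rm test})\big)=\sum_{y\in\mathcal{Y}}\sigma\!\left(k\left(\frac1\alpha-\frac{S(X_{\rm test},y)}{\frac{1}{n+1}\left(\sum_{i=1}^nS(X_i,Y_i)+S(X_{\rm test},y)\right)}\right)\right),$$ $$\mathrm{Size}\big(\hat C_{n-1}^{\alpha}(X_j)\big)=\sum_{y\in\mathcal{Y}}\sigma\!\left(k\left(\frac1\alpha-\frac{S(X_j,y)}{\frac{1}{n}\left(\sum_{i\ne j}S(X_i,Y_i)+S(X_j,y)\right)}\right)\right),\quad 1\le j\le n.$$ (ii) (Regression, MAE score) $\mathcal{Y}\subseteq\mathbb{R}$, $S(x,y)=|f(x)-y|$ for a fixed predictor $f:\mathcal{X}\to\mathbb{R}$, $S$ takes values in $[0,S_{\max}]$ with $S_{\max}<\infty$,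 $\alpha>1/n$, and the sizes are $$\mathrm{Size}\big(\hat C_n^{\alpha}(X_{\rm test})\big)=\frac{2\sum_{i=1}^nS(X_i,Y_i)}{(n+1)\alpha-1},\qquad \mathrm{Size}\big(\hat C_{n-1}^{\alpha}(X_j)\big)=\frac{2\sum_{i\neq j}S(X_i,Y_i)}{n\alpha-1},\quad 1\le j\le n.$$ Let $\overline{\mathrm{Size}}_n:=\frac1n\sum_{j=1}^n\mathrm{Size}\big(\hat C_{n-1}^{\alpha}(X_j)\big)$. Then, under either (i) or (ii), as $n\to\infty$, $$\Big|\overline{\mathrm{Size}}_n-\mathbb{E}\big[\mathrm{Size}\big(\hat C_n^{\alpha}(X_{\rm test})\big)\big]\Big|=O_P\!\left(\frac{1}{\sqrt n}\right).$$
   Context: $\mathcal{X}\times\mathcal{Y}$ is the (measurable) feature-label space; score functions and predictors are measurable and do not depend on the calibration or test data. $\sigma(x)=1/(1+e^{-x})$ is the sigmoid function. All sums $\sum_{i\neq j}$ run over $i\in\{1,\dots,n\}\setminus\{j\}$. In the sizes above, $\hat C_n^{\alpha}(x)$ refers to the conformal set $\big\{y\in\mathcal{Y}: S(x,y)\big/\big[\tfrac{1}{n+1}\big(\sum_{i=1}^nS(X_i,Y_i)+S(x,y)\big)\big]<1/\alpha\big\}$ built from the calibration set of size $n$, and $\hat C_{n-1}^{\alpha}(X_j)$ to the analogous leave-one-out set at $x=X_j$ built from the $n-1$ calibration points $(X_i,Y_i)$, $i\ne j$ (with $\tfrac1{n+1}$ replaced by $\tfrac1n$). For the purposes of the theorem,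 ''Size'' is given by the explicit formulas in the claim. $Z_n=O_P(1/\sqrt n)$ means that $\sqrt n\,Z_n$ is bounded in probability: for every $\varepsilon>0$ there are $C<\infty$ and $N$ such that $\mathbb{P}(\sqrt n\,|Z_n|>C)\le\varepsilon$ for all $n\ge N$. The quantities $\alpha$, $k$, $S_{\min}$, $S_{\max}$, $\mathcal{Y}$, $S$ and the data distribution do not depend on $n$; the conditions $n>S_{\max}/S_{\min}$ and $\alpha>1/n$ hold for all large $n$. *)

(* Defs.v *)
From HB Require Import structures.
From mathcomp Require Import all_boot all_order all_algebra.
From mathcomp Require Import finmap.
From mathcomp Require Import all_classical all_reals all_analysis.

Set Implicit Arguments.
Unset Strict Implicit.
Unset Printing Implicit Defensive.

Import Order.TTheory GRing.Theory Num.Theory.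
Import numFieldNormedType.Exports.

Local Open Scope classical_set_scope.
Local Open Scope ring_scope.

Section Independence.
Context {R : realType} {d dT : measure_display} {Omega : measurableType d}
        {T : measurableType dT}.
Variable P : probability Omega R.

Definition mutually_independent (Z : nat -> Omega -> T) : Prop :=
  forall (J : {fset nat}) (A : nat -> set T), (forall i, measurable (A i)) ->
    P (\bigcap_(i in [set` J]) (Z i @^-1` A i)) =
    (\prod_(i <- J) P (Z i @^-1` A i))%E.

Definition sigma_of_sequence (Z : nat -> Omega -> T) : set (set Omega) :=
  <<s \bigcup_i preimage_set_system [set: Omega] (Z i) measurable >>.

(* W is independent of the whole sequence Z: sigma(W) and sigma(Z_0, Z_1, ...)
   are independent sigma-algebras *)
Definition independent_of_sequence (W : Omega -> T) (Z : nat -> Omega -> T) :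
    Prop :=
  forall (A : set T) (E : set Omega), measurable A -> sigma_of_sequence Z E ->
    P (W @^-1` A `&` E) = (P (W @^-1` A) * P E)%E.

Definition same_distribution (W W' : {RV P >-> T}) : Prop :=
  forall A : set T, measurable A -> distribution P W A = distribution P W' A.

Definition iid_with_test (Z : nat -> {RV P >-> T}) (Ztest : {RV P >-> T}) :
    Prop :=
  [/\ mutually_independent (fun i => Z i : Omega -> T),
      forall i, same_distribution (Z i) Ztest
    & independent_of_sequence Ztest (fun i => Z i : Omega -> T)].

(* Z_n = O_P(1 / sqrt n). Values are extended reals so that Z_n can contain an
   expectation, which is a priori in \bar R. *)
Definition OP_inv_sqrt (Z : nat -> Omega -> \bar R) : Prop :=
  forall eps : R, 0 < eps -> exists (C : R) (N : nat), forall n : nat,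
    (N <= n)%N ->
    (P [set w | C%:E < (Num.sqrt n%:R)%:E * `|Z n w| ] <= eps%:E)%E.

End Independence.

Definition sigmoid {R : realType} (x : R) : R := (1 + expR (- x))^-1.

(* In all the sizes below, calibration points are numbered from 0: Z i w is the
   pair (X_{i+1}, Y_{i+1}), the calibration set of size n is Z 0, ..., Z n.-1,
   and a loo size with arguments n, j (j < n) leaves out Z j. *)
Definition mean_loo_size {R : realType} {Omega : Type}
    (loo : nat -> nat -> Omega -> R) (n : nat) (w : Omega) : R :=
  n%:R^-1 * \sum_(j < n) loo n j w.

Section ClassificationSizes.
Context {R : realType} {Omega X : Type} {Y : choiceType}.
Variables (k alpha : R) (S : X * Y -> R) (Z : nat -> Omega -> X * Y).

Definition sigmoid_size_test (Ztest : Omega -> X * Y) (n : nat)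
    (w : Omega) : R :=
  \sum_(y \in [set: Y])
    sigmoid (k * (alpha^-1 -
      S ((Ztest w).1, y) /
      (n.+1%:R^-1 * (\sum_(i < n) S (Z i w) + S ((Ztest w).1, y))))).

Definition sigmoid_size_loo (n j : nat) (w : Omega) : R :=
  \sum_(y \in [set: Y])
    sigmoid (k * (alpha^-1 -
      S ((Z j w).1, y) /
      (n%:R^-1 * (\sum_(i < n | i != j :> nat) S (Z i w) + S ((Z j w).1, y))))).

End ClassificationSizes.

Section RegressionSizes.
Context {R : realType} {Omega X : Type}.
Variables (alpha : R) (S : X * R -> R) (Z : nat -> Omega -> X * R).

Definition mae_size_test (n : nat) (w : Omega) : R :=
  2 * (\sum_(i < n) S (Z i w)) / (n.+1%:R * alpha - 1).

Definition mae_size_loo (n j : nat) (w : Omega) : R :=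
  2 * (\sum_(i < n | i != j :> nat) S (Z i w)) / (n%:R * alpha - 1).

End RegressionSizes.

Definition mae_score {R : realType} {X : Type} (f : X -> R) (z : X * R) : R :=
  `|f z.1 - z.2|.

(* Main.v *)
(* Averages over the sample of a bounded function h >= 0 satisfy
   E (n^-1 sum_i h(Z_i) - E h)^2 <= B^2 / n, by pairwise independence, and
   an L^2 bound K / n gives O_P(1 / sqrt n) by Markov's inequality.
   (ii) The mean leave-one-out size is 2 (n - 1) / (n alpha - 1) times the
   average score, and replacing this coefficient by the one of the test size
   costs O(1 / n).
   (i) The smoothed size is a Lipschitz function of the average score in its
   denominator, since that average stays above Smin; all the denominators are
   within Smax / n of the sample average U_n of the scores.  With mu = E S and
   g(x) = sum_y sigmoid (k (1/alpha - S(x,y) / mu)), every leave-one-out size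
   and the test size differ from g by at most L (|U_n - mu| + Smax / n), and
   n^-1 sum_j g(X_j) concentrates around E g(X_test). *)
Require Import Defs.
From HB Require Import structures.
From mathcomp Require Import all_boot all_order all_algebra.
From mathcomp Require Import finmap ring lra.
From mathcomp Require Import all_classical all_reals all_analysis measurable_realfun.

Set Implicit Arguments.
Unset Strict Implicit.
Unset Printing Implicit Defensive.

Import Order.TTheory GRing.Theory Num.Theory.
Import numFieldNormedType.Exports.

Local Open Scope classical_set_scope.
Local Open Scope ring_scope.

(** A class closed under the ring operations and integrable for any probability; membership in it
    supplies the integrability conditions of the mean lemmas. *)
Definition bounded_measurable {R : realType} {d} {Omega : measurableType d}
    (X : Omega -> R) : Prop :=
  measurable_fun [set: Omega] X /\ exists M : R, forall w, `|X w| <= M.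

(** * Bounded measurable functions and their means *)

Section BoundedMeasurable.
Context {R : realType} {d : measure_display} {Omega : measurableType d}.
Implicit Types X Y : Omega -> R.

Lemma bounded_measurable_cst (c : R) :
  bounded_measurable (fun _ : Omega => c).
Proof. by split; [exact: measurable_cst | exists `|c|]. Qed.

Lemma bounded_measurableD X Y : bounded_measurable X -> bounded_measurable Y ->
  bounded_measurable (fun w => X w + Y w).
Proof.
move=> [mX [M XM]] [mY [N YN]]; split; first exact: measurable_funD.
by exists (M + N) => w; rewrite (le_trans (ler_normD _ _))// lerD.
Qed.

Lemma bounded_measurableM X Y : bounded_measurable X -> bounded_measurable Y ->
  bounded_measurable (fun w => X w * Y w).
Proof.
move=> [mX [M XM]] [mY [N YN]]; split; first exact: measurable_funM.
by exists (M * N) => w; rewrite normrM ler_pM.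
Qed.

Lemma bounded_measurableN X : bounded_measurable X ->
  bounded_measurable (fun w => - X w).
Proof.
move=> [mX [M XM]]; split; first exact: measurableT_comp.
by exists M => w; rewrite normrN.
Qed.

Lemma bounded_measurableB X Y : bounded_measurable X -> bounded_measurable Y ->
  bounded_measurable (fun w => X w - Y w).
Proof.
by move=> mX mY; exact: (bounded_measurableD mX (bounded_measurableN mY)).
Qed.

Lemma bounded_measurableX X n : bounded_measurable X ->
  bounded_measurable (fun w => X w ^+ n).
Proof.
move=> [mX [M XM]]; split; first exact: measurable_funX.
exists (M ^+ n) => w; have M0 := le_trans (normr_ge0 _) (XM w).
by rewrite normrX lerXn2r ?nnegrE.
Qed.

Lemma bounded_measurable_norm X : bounded_measurable X ->
  bounded_measurable (fun w => `|X w|).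
Proof.
move=> [mX [M XM]]; split; first exact: measurableT_comp.
by exists M => w; rewrite normr_id.
Qed.

Lemma bounded_measurable_sum (I : Type) (s : seq I) (p : pred I)
    (F : I -> Omega -> R) : (forall i, bounded_measurable (F i)) ->
  bounded_measurable (fun w => \sum_(i <- s | p i) F i w).
Proof.
move=> bF; elim: s => [|i s IHs].
  rewrite (_ : (fun w => _) = fun=> 0); first exact: bounded_measurable_cst.
  by apply/funext => w; rewrite big_nil.
have [pi|pi] := boolP (p i).
  rewrite (_ : (fun w => _) =
      fun w => F i w + \sum_(j <- s | p j) F j w).
    exact: bounded_measurableD.
  by apply/funext => w; rewrite big_cons pi.
rewrite (_ : (fun w => _) = fun w => \sum_(j <- s | p j) F j w)//.
by apply/funext => w; rewrite big_cons (negbTE pi).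
Qed.

Context (P : probability Omega R).

Lemma bounded_measurable_integrable X : bounded_measurable X ->
  P.-integrable [set: Omega] (EFin \o X).
Proof.
move=> [mX [M XM]]; apply: measurable_bounded_integrable => //.
  by rewrite (le_lt_trans (probability_le1 P measurableT))// ltry.
by exists M; split; rewrite ?num_real// => x Mx w _ /=; rewrite (le_trans (XM w))// ltW.
Qed.

Lemma expectation_Rintegral X : bounded_measurable X ->
  ('E_P[X] = (\int[P]_w X w)%R%:E)%E.
Proof.
move=> bX; rewrite unlock /Rintegral fineK//.
exact/integrable_fin_num/bounded_measurable_integrable.
Qed.

Lemma meanD X Y : bounded_measurable X -> bounded_measurable Y ->
  \int[P]_w (X w + Y w) = \int[P]_w X w + \int[P]_w Y w.
Proof. by move=> *; apply: RintegralD => //; exact: bounded_measurable_integrable. Qed.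

Lemma meanB X Y : bounded_measurable X -> bounded_measurable Y ->
  \int[P]_w (X w - Y w) = \int[P]_w X w - \int[P]_w Y w.
Proof. by move=> *; apply: RintegralB => //; exact: bounded_measurable_integrable. Qed.

Lemma meanZ (c : R) X : bounded_measurable X ->
  \int[P]_w (c * X w) = c * \int[P]_w X w.
Proof. by move=> *; apply: RintegralZl => //; exact: bounded_measurable_integrable. Qed.

Lemma mean_cst (c : R) : \int[P]_w c = c.
Proof. by rewrite Rintegral_cst// (congr1 fine (probability_setT P)) mulr1. Qed.

Lemma mean_le X Y : bounded_measurable X -> bounded_measurable Y ->
  (forall w, X w <= Y w) -> \int[P]_w X w <= \int[P]_w Y w.
Proof. by move=> *; apply: le_Rintegral => //; exact: bounded_measurable_integrable. Qed.

Lemma mean_sum (I : Type) (s : seq I) (p : pred I) (F : I -> Omega -> R) :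
  (forall i, bounded_measurable (F i)) ->
  \int[P]_w (\sum_(i <- s | p i) F i w) = \sum_(i <- s | p i) \int[P]_w F i w.
Proof.
move=> bF; elim: s => [|i s IHs].
  by rewrite big_nil -[RHS](mean_cst 0); apply: eq_Rintegral => w _; rewrite big_nil.
rewrite big_cons -IHs; under eq_Rintegral do rewrite big_cons.
by case: (p i) => //; rewrite meanD//; exact: bounded_measurable_sum.
Qed.

(** Expanding the nonnegative variance, the mean of [(X w - m) ^+ 2], gives the inequality. *)
Lemma sqr_mean_le X : bounded_measurable X ->
  (\int[P]_w X w) ^+ 2 <= \int[P]_w (X w ^+ 2).
Proof.
move=> bX; set m := \int[P]_w X w.
have bcX : bounded_measurable (fun w => 2 * m * X w).
  by apply: bounded_measurableM => //; exact: bounded_measurable_cst.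
have : 0 <= \int[P]_w ((X w - m) ^+ 2) by apply: Rintegral_ge0 => w _; exact: sqr_ge0.
rewrite (_ : \int[P]_w _ = \int[P]_w (X w ^+ 2 - 2 * m * X w + m ^+ 2)); last first.
  by apply: eq_Rintegral => w _; ring.
have bX2 := bounded_measurableX 2 bX.
rewrite meanD; [|exact: bounded_measurableB|exact: bounded_measurable_cst].
rewrite meanB// meanZ// mean_cst.
by rewrite -/m; nra.
Qed.

End BoundedMeasurable.

(** * Transfer of integrals through laws, and products of independent variables *)

Section MeanProduct.
Context {R : realType} {d dT : measure_display} {Omega : measurableType d}
  {T : measurableType dT} (P : probability Omega R).

(** Each side is the integral of [h] against the image law, and the two laws agree on measurable
    sets. *)
Lemma same_distribution_integral (W W' : {RV P >-> T}) (h : T -> \bar R) :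
  same_distribution W W' -> measurable_fun [set: T] h -> (forall z, 0 <= h z)%E ->
  (\int[P]_w h (W w) = \int[P]_w h (W' w))%E.
Proof.
move=> WW' mh h0.
rewrite -[LHS](ge0_integral_distribution W mh h0).
rewrite -[RHS](ge0_integral_distribution W' mh h0).
by apply: eq_measure_integral => A mA _; exact: WW'.
Qed.

Lemma independent_pair (Z : nat -> {RV P >-> T}) (i j : nat) (A B : set T) :
  mutually_independent P (fun i => Z i : Omega -> T) -> i != j ->
  measurable A -> measurable B ->
  P (Z i @^-1` A `&` Z j @^-1` B) = (P (Z i @^-1` A) * P (Z j @^-1` B))%E.
Proof.
move=> indep ij mA mB.
(* Mutual independence takes a whole family of events; only its values at [i] and [j] matter for the
   index set [[fset i; j]]. *)
pose C k := if k == i then A else B.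
have mC k : measurable (C k) by rewrite /C; case: ifP.
have /= := indep [fset i; j]%fset C mC.
rewrite big_fsetU1/= ?inE// big_seq_fset1 /C eqxx eq_sym (negbTE ij) => <-.
congr (P _); apply/seteqP; split => w /=.
  by move=> [Aw Bw] k /=; rewrite !inE => /orP[] /eqP ->;
    rewrite ?eqxx // eq_sym (negbTE ij).
move=> H; split.
  by have := H i; rewrite /= !inE eqxx; exact.
by have := H j; rewrite /= !inE eqxx orbT eq_sym (negbTE ij); exact.
Qed.

(** The law of the pair [(Z i, Z j)] is the product of the marginal laws, and Tonelli, available
    because [h] is nonnegative, factors the integral. *)
Lemma independent_integralM (Z : nat -> {RV P >-> T}) (i j : nat)
    (h : T -> R) :
  mutually_independent P (fun i => Z i : Omega -> T) -> i != j ->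
  measurable_fun [set: T] h -> (forall z, 0 <= h z) ->
  (\int[P]_w (h (Z i w) * h (Z j w))%:E =
   (\int[P]_w (h (Z i w))%:E) * (\int[P]_w (h (Z j w))%:E))%E.
Proof.
move=> indep ij mh h0.
pose W w := (Z i w, Z j w).
have mW : measurable_fun [set: Omega] W.
  by apply: measurable_fun_pair; exact: measurable_funPT.
pose W' : {RV P >-> (T * T)%type} :=
  HB.pack W (isMeasurableFun.Build _ _ _ _ W mW).
have mhE : measurable_fun [set: T] (EFin \o h) by exact/measurable_EFinP.
have h0E z : (0 <= (EFin \o h) z)%E by rewrite lee_fin.
pose g (z : T * T) := (h z.1 * h z.2)%:E.
have mg : measurable_fun [set: T * T] g.
  apply/measurable_EFinP; apply: measurable_funM;
    exact: measurableT_comp.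
have g0 z : (0 <= g z)%E by rewrite lee_fin mulr_ge0.
have -> : (\int[P]_w (h (Z i w) * h (Z j w))%:E =
           \int[distribution P W']_z g z)%E.
  by rewrite ge0_integral_distribution.
rewrite -(ge0_integral_distribution (Z i) mhE h0E).
rewrite -(ge0_integral_distribution (Z j) mhE h0E).
transitivity (\int[distribution P (Z i) \x distribution P (Z j)]_z g z)%E.
  (* A measure that factors on measurable rectangles is the product measure; on rectangles this is
     pairwise independence. *)
  apply: eq_measure_integral => A mA _; symmetry.
  apply: product_measure_unique => // B C mB mC.
  rewrite -[RHS](independent_pair indep ij mB mC).
  by rewrite /distribution/= /pushforward; congr (P _).
rewrite fubini_tonelli1//.
rewrite -ge0_integralZr//; last first.
  by apply: integral_ge0 => z _; exact: h0E.
apply: eq_integral => x _; rewrite /fubini_F /g/=.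
under eq_integral do rewrite EFinM.
by apply: ge0_integralZl_EFin => // z _; exact: h0E.
Qed.

End MeanProduct.

(** * Variance of an average, and from second moments to bounds in probability *)

Section Concentration.
Context {R : realType} {d : measure_display} {Omega : measurableType d}.
Variable P : probability Omega R.

(** The cross terms of the squared sum have mean exactly [m * m], so after centering only the
    diagonal, of order [n], survives the division by the square of [n]. *)
Lemma variance_average (U : nat -> Omega -> R) (B m : R) (n : nat) :
  (forall i, measurable_fun [set: Omega] (U i)) ->
  (forall i w, 0 <= U i w <= B) ->
  (forall i, \int[P]_w U i w = m) ->
  (forall i j, i != j -> \int[P]_w (U i w * U j w) = m * m) ->
  (0 < n)%N ->
  \int[P]_w ((n%:R^-1 * \sum_(i < n) U i w - m) ^+ 2) <= B ^+ 2 / n%:R.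
Proof.
move=> mU UB Um UU n0.
have bU i : bounded_measurable (U i).
  by split => //; exists B => w; have /andP[U0 UBi] := UB i w; rewrite ger0_norm.
have bUU i j : bounded_measurable (fun w => U i w * U j w).
  exact: bounded_measurableM.
have nR : n%:R != 0 :> R by rewrite pnatr_eq0 -lt0n.
pose V w := \sum_(i < n) U i w.
have bV : bounded_measurable V by exact: bounded_measurable_sum.
have EV : \int[P]_w V w = n%:R * m.
  rewrite mean_sum//; under eq_bigr do rewrite Um.
  by rewrite sumr_const card_ord mulr_natl.
(* Each of the [n] rows of the double sum has one diagonal term, at most [B ^+ 2], and [n - 1] terms
   equal to [m ^+ 2]. *)
have EV2 : \int[P]_w (V w ^+ 2) <= n%:R * (B ^+ 2 + (n%:R - 1) * m ^+ 2).
  have -> : \int[P]_w (V w ^+ 2) =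
      \sum_(i < n) \sum_(j < n) \int[P]_w (U i w * U j w).
    under [RHS]eq_bigr do rewrite -mean_sum//.
    rewrite -mean_sum; last by move=> i; exact: bounded_measurable_sum.
    by apply: eq_Rintegral => w _; rewrite expr2 big_distrlr.
  rewrite mulr_natl -[in leRHS](card_ord n) -sumr_const; apply: ler_sum => i _.
  rewrite (bigD1 i)//= lerD//.
    rewrite -(mean_cst P (B ^+ 2)); apply: mean_le => //.
      exact: bounded_measurable_cst.
    by move=> w; have /andP[U0 UBi] := UB i w; rewrite -expr2 lerXn2r ?nnegrE// (le_trans U0).
  under eq_bigr => j ji do rewrite UU 1?eq_sym//.
  rewrite sumr_const cardC1 card_ord -[leLHS]mulr_natl -expr2.
  by rewrite -subn1 natrB.
have -> : \int[P]_w ((n%:R^-1 * \sum_(i < n) U i w - m) ^+ 2) =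
    \int[P]_w (n%:R^-2 * V w ^+ 2 - 2 * m * n%:R^-1 * V w + m ^+ 2).
  by apply: eq_Rintegral => w _; rewrite -/(V w) -exprVn; ring.
have bV2 := bounded_measurableX 2 bV.
have bZ c X : bounded_measurable X -> bounded_measurable (fun w : Omega => c * X w : R).
  by apply: bounded_measurableM; exact: bounded_measurable_cst.
rewrite meanD; [|by apply: bounded_measurableB; exact: bZ
                |exact: bounded_measurable_cst].
rewrite mean_cst meanB; [|exact: bZ|exact: bZ].
rewrite !meanZ// EV.
have n2 : 0 <= n%:R^-2 :> R by rewrite invr_ge0 exprn_ge0.
have := ler_wpM2l n2 EV2.
have -> : n%:R^-2 * (n%:R * (B ^+ 2 + (n%:R - 1) * m ^+ 2)) =
    B ^+ 2 / n%:R + m ^+ 2 - m ^+ 2 / n%:R by field.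
have -> : 2 * m * n%:R^-1 * (n%:R * m) = 2 * m ^+ 2 by field.
have : 0 <= m ^+ 2 / n%:R by rewrite divr_ge0// sqr_ge0.
lra.
Qed.

(** Chebyshev: [Num.sqrt n%:R * D n] has second moment at most [K], uniformly in [n >= N]. *)
Lemma OP_inv_sqrt_mean_sqr (D : nat -> Omega -> R) (K : R) (N : nat) :
  (forall n, measurable_fun [set: Omega] (D n)) ->
  (forall n, (N <= n)%N -> bounded_measurable (D n) /\
     \int[P]_w (D n w ^+ 2) <= K / n%:R) ->
  OP_inv_sqrt P (fun n w => `|(D n w)%:E|%E).
Proof.
(* The summand 1 gives [C >= 1], hence [C ^+ 2 >= C >= |K| / eps] without a square root. The [maxn]
   makes [n] positive, so that [K / n%:R] can be multiplied back by [n]. *)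
move=> mD DK eps eps0; exists (`|K| / eps + 1), (maxn N 1) => n.
rewrite geq_max => /andP[Nn n0].
have [bD EDn] := DK n Nn.
set C := _ + 1.
have C1 : 1 <= C by rewrite lerDr divr_ge0// ltW.
have C0 : 0 < C by exact: lt_le_trans C1.
pose X w := Num.sqrt n%:R * D n w.
have mX : measurable_fun [set: Omega] X by exact: measurable_funM.
have bX : bounded_measurable X.
  by apply: bounded_measurableM => //; exact: bounded_measurable_cst.
pose X' : {RV P >-> R} := HB.pack X (isMeasurableFun.Build _ _ _ _ X mX).
have := @markov _ _ _ P X' (fun x => x ^+ 2) C C0.
move=> /(_ (measurable_funX _ _)) mk.
have {mk} := mk (@measurable_id _ _ setT) (fun r _ => sqr_ge0 r).
have -> : ('E_P[((fun x => x ^+ 2) \o (fun x => `|x|) \o X')%R] =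
    (\int[P]_w (X w ^+ 2))%:E)%E.
  rewrite -expectation_Rintegral; last exact: bounded_measurableX.
  by congr expectation; apply/funext => w /=; rewrite real_normK ?num_real.
have XK : \int[P]_w (X w ^+ 2) <= K.
  under eq_Rintegral do rewrite exprMn sqr_sqrtr//.
  rewrite meanZ; last exact: bounded_measurableX.
  by rewrite mulrC -ler_pdivlMr ?ltr0n.
move=> mk.
have {}mk : ((C ^+ 2)%:E * P [set x | (C%:E <= `|(X' x)%:E|)%E] <= K%:E)%E.
  apply: le_trans (mk _) _; last by rewrite lee_fin.
  by move=> x y; rewrite !nnegrE => x0 y0 xy; rewrite lerXn2r.
have mnX : measurable_fun [set: Omega] (fun w => `|X w|) by exact: measurableT_comp.
(* Markov controls the event with a weak inequality, which contains the strict one of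
   [OP_inv_sqrt]. *)
apply: (@le_trans _ _ (P [set w | C <= `|X w|])).
  rewrite (_ : [set w | _] = [set w | C < `|X w|]); last first.
    apply/seteqP; split => w /=;
      by rewrite normr_id -EFinM lte_fin normrM (ger0_norm (sqrtr_ge0 _)).
  apply: le_measure; rewrite ?inE; last by move=> w /ltW.
  - have := mnX measurableT `]C, +oo[%classic (measurable_itv _).
    by rewrite setTI (_ : _ @^-1` _ = [set w | C < `|X w|])//;
      apply/seteqP; split => w /=; rewrite in_itv/= andbT.
  - have := mnX measurableT `[C, +oo[%classic (measurable_itv _).
    by rewrite setTI (_ : _ @^-1` _ = [set w | C <= `|X w|])//;
      apply/seteqP; split => w /=; rewrite in_itv/= andbT.
have C2 : 0 < C ^+ 2 by rewrite exprn_gt0.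
rewrite -(@lee_pmul2l _ (C ^+ 2)%:E)// ?lte_fin//.
apply: (le_trans mk); rewrite -EFinM lee_fin.
rewrite (le_trans (ler_norm K))// -ler_pdivrMr//.
rewrite (@le_trans _ _ C)//; first by rewrite lerDl.
by rewrite expr2 ler_peMr// ltW.
Qed.

End Concentration.

(** * Averages of a function of the i.i.d. sample *)

Section IidAverage.
Context {R : realType} {d dT : measure_display} {Omega : measurableType d}
  {T : measurableType dT} (P : probability Omega R).
Variables (Z : nat -> {RV P >-> T}) (Ztest : {RV P >-> T}).
Hypothesis iidZ : iid_with_test Z Ztest.
(** The upper bound is asked only along the sample: the MAE score is bounded only for labels in the
    label set. *)
Variables (h : T -> R) (B : R).
Hypotheses (mh : measurable_fun [set: T] h) (h0 : forall z, 0 <= h z)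
  (hB : forall i w, h (Z i w) <= B).

Lemma bounded_measurable_sample i : bounded_measurable (fun w => h (Z i w)).
Proof.
split; first by apply: measurableT_comp => //; exact: measurable_funPT.
by exists B => w; rewrite ger0_norm.
Qed.

Lemma iid_mean i : \int[P]_w h (Z i w) = \int[P]_w h (Ztest w).
Proof.
case: iidZ => _ idZ _; congr fine.
apply: (same_distribution_integral (idZ i) (h := EFin \o h)).
  exact/measurable_EFinP.
by move=> z; rewrite lee_fin.
Qed.

Lemma iid_variance_average n : (0 < n)%N ->
  \int[P]_w ((n%:R^-1 * \sum_(i < n) h (Z i w) - \int[P]_w h (Ztest w)) ^+ 2)
    <= B ^+ 2 / n%:R.
Proof.
have bh := bounded_measurable_sample.
apply: (variance_average (U := fun i w => h (Z i w))).
- by move=> i; have [] := bh i.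
- by move=> i w; rewrite h0 hB.
- exact: iid_mean.
move=> i j ij; case: (iidZ) => indep _ _.
rewrite -{1}(iid_mean i) -(iid_mean j) /Rintegral.
rewrite (independent_integralM indep ij mh h0) fineM//;
  exact/integrable_fin_num/bounded_measurable_integrable.
Qed.

End IidAverage.

Lemma sum_leave_one_out (V : zmodType) (n : nat) (U : nat -> V) (j : 'I_n) :
  \sum_(i < n | i != j :> nat) U i = \sum_(i < n) U i - U j.
Proof. by rewrite [in RHS](bigD1 j)//= [RHS]addrC addKr. Qed.

(** * Case (ii): regression with the MAE score *)

Section Regression.
Context {R : realType} {d dX : measure_display} {Omega : measurableType d}
  {TX : measurableType dX} (P : probability Omega R).

(** Every score is left out exactly once, so it occurs in [n - 1] of the [n] leave-one-out sums. *)
Lemma mean_mae_size_loo (alpha : R) (S : TX * R -> R)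
    (Z : nat -> Omega -> TX * R) n w : (0 < n)%N ->
  mean_loo_size (mae_size_loo alpha S Z) n w =
  2 * (n%:R - 1) / (n%:R * alpha - 1) * (n%:R^-1 * \sum_(i < n) S (Z i w)).
Proof.
move=> n0; rewrite /mean_loo_size /mae_size_loo.
under eq_bigr do rewrite (sum_leave_one_out (fun i => S (Z i w))).
rewrite -mulr_suml -mulr_sumr sumrB sumr_const card_ord -[_ *+ n]mulr_natl.
have nR : n%:R != 0 :> R by rewrite pnatr_eq0 -lt0n.
set x := \sum_(i < n) _; move: (_ - 1)^-1 => c.
by field.
Qed.

(** From [n * alpha >= 2] the denominator is at least [n * alpha / 2]. *)
Lemma regression_coef_bound (alpha : R) (n : R) : 0 < alpha < 1 ->
  2 <= n * alpha -> 0 <= 2 * (n - 1) / (n * alpha - 1) <= 4 / alpha.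
Proof.
move=> /andP[a0 a1] na.
have n1 : 1 <= n by nra.
have na1 : 0 < n * alpha - 1 by lra.
apply/andP; split; first by rewrite divr_ge0//; lra.
rewrite ler_pdivrMr// mulrAC ler_pdivlMr//; nra.
Qed.

(** Over the common denominator the numerator collapses to [2 * (1 - alpha)]. One factor of the
    denominator is at least [n * alpha / 2], the other at least 1. *)
Lemma regression_bias_bound (alpha : R) (n : R) : 0 < alpha < 1 ->
  2 <= n * alpha ->
  0 <= 2 * (n - 1) / (n * alpha - 1) - 2 * n / ((n + 1) * alpha - 1)
    <= 4 / alpha / n.
Proof.
move=> /andP[a0 a1] na.
have n1 : 1 <= n by nra.
have na1 : 0 < n * alpha - 1 by lra.
have na2 : 1 <= (n + 1) * alpha - 1 by nra.
have -> : 2 * (n - 1) / (n * alpha - 1) - 2 * n / ((n + 1) * alpha - 1) =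
    2 * (1 - alpha) / ((n * alpha - 1) * ((n + 1) * alpha - 1)).
  by field; rewrite !gt_eqF//; lra.
apply/andP; split.
  by rewrite divr_ge0 ?mulr_ge0//; lra.
have an : 0 < alpha * n by nra.
have H : 2 <= 4 / alpha / n * (n * alpha - 1).
  rewrite -[4 / _ / _]mulrA -invfM mulrAC ler_pdivlMr//; nra.
rewrite ler_pdivrMr ?mulr_gt0//; last lra.
rewrite mulrA; nra.
Qed.

Lemma regression_OP (alpha : R) (halpha : 0 < alpha < 1) (Y : set R)
    (Z : nat -> {RV P >-> (TX * measurableTypeR R)%type})
    (Ztest : {RV P >-> (TX * measurableTypeR R)%type})
    (f : TX -> R) (Smax : R) :
  iid_with_test Z Ztest ->
  (forall i w, Y (Z i w).2) ->
  measurable_fun [set: TX] f ->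
  (forall x y, Y y -> 0 <= mae_score f (x, y) <= Smax) ->
  OP_inv_sqrt P (fun n w =>
    `| (mean_loo_size (mae_size_loo alpha (mae_score f) Z) n w)%:E
       - 'E_P[mae_size_test alpha (mae_score f) Z n] |)%E.
Proof.
move=> iidZ YZ mf fY.
pose h := mae_score f : (TX * measurableTypeR R)%type -> R.
have mh : measurable_fun [set: (TX * measurableTypeR R)%type] h.
  apply: measurableT_comp => //; apply: measurable_funB => //.
  exact: measurableT_comp.
have h0 z : 0 <= h z by exact: normr_ge0.
have hB i w : h (Z i w) <= Smax.
  by rewrite /h; have := YZ i w; case: (Z i w) => x y /(fY x)/andP[].
have bh := bounded_measurable_sample mh h0 hB.
pose m := \int[P]_w h (Ztest w).
have Um i : \int[P]_w h (Z i w) = m by exact: iid_mean.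
have var n : (0 < n)%N -> _ := iid_variance_average iidZ mh h0 hB (n := n).
have mB : m <= Smax.
  rewrite -(Um 0%N) -(mean_cst P Smax); apply: mean_le => //.
  exact: bounded_measurable_cst.
have m0 : 0 <= m by apply: Rintegral_ge0.
pose c n : R := 2 / (n.+1%:R * alpha - 1).
have bS n : bounded_measurable (fun w => \sum_(i < n) h (Z i w)).
  by apply: bounded_measurable_sum.
have Etest n : \int[P]_w mae_size_test alpha h Z n w =
    2 * n%:R / (n.+1%:R * alpha - 1) * m.
  rewrite (_ : \int[P]_w _ = \int[P]_w (c n * \sum_(i < n) h (Z i w))); last first.
    by apply: eq_Rintegral => w _; rewrite /mae_size_test /c; ring.
  rewrite meanZ// mean_sum//; under eq_bigr do rewrite Um.
  by rewrite sumr_const card_ord /c -mulr_natl; ring.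
pose D n w := mean_loo_size (mae_size_loo alpha h Z) n w -
  2 * n%:R / (n.+1%:R * alpha - 1) * m.
(* This holds for all [n]: the coefficients are constants, also where a denominator vanishes and its
   inverse is 0 by convention. *)
have bD n : bounded_measurable (D n).
  apply: bounded_measurableB; last exact: bounded_measurable_cst.
  apply: bounded_measurableM; first exact: bounded_measurable_cst.
  apply: bounded_measurable_sum => j.
  apply: bounded_measurableM; last exact: bounded_measurable_cst.
  apply: bounded_measurableM; first exact: bounded_measurable_cst.
  exact: bounded_measurable_sum.
rewrite (_ : (fun n w => _) = fun n w => `|(D n w)%:E|%E); last first.
  apply/funext => n; apply/funext => w; rewrite expectation_Rintegral ?Etest//.
  apply: bounded_measurableM; last exact: bounded_measurable_cst.
  by apply: bounded_measurableM; first exact: bounded_measurable_cst.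
have /andP[a0 a1] := halpha.
(* The constant is 2 * 16 for the fluctuation plus 2 * 16 for the bias, 16 being the square of the 4
   in the coefficient bounds. The threshold ensures [n * alpha >= 2], and its successor [n > 0]. *)
apply: (@OP_inv_sqrt_mean_sqr _ _ _ P D (64 * Smax ^+ 2 / alpha ^+ 2)
  (Num.bound (2 / alpha)).+1) => [n|n Nn]; first by have [] := bD n.
split => //.
have n0 : (0 < n)%N by apply: leq_trans Nn.
have nR : 1 <= n%:R :> R by rewrite ler1n.
have na : 2 <= n%:R * alpha.
  rewrite -ler_pdivrMr//; apply/ltW.
  apply: (lt_le_trans (archi_boundP _)); first by rewrite divr_ge0// ltW.
  by rewrite ler_nat ltnW.
have /andP[c0 c1] := regression_coef_bound halpha na.
have /andP[] := regression_bias_bound halpha na.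
set p := 2 * (n%:R - 1) / _ in c0 c1 *; set q := 2 * n%:R / _ => e0 e1.
pose A w := n%:R^-1 * \sum_(i < n) h (Z i w) - m.
have bA : bounded_measurable A.
  apply: bounded_measurableB; last exact: bounded_measurable_cst.
  by apply: bounded_measurableM; first exact: bounded_measurable_cst.
have bZ k X : bounded_measurable X -> bounded_measurable (fun w : Omega => k * X w : R).
  by apply: bounded_measurableM; exact: bounded_measurable_cst.
have bA2 := bounded_measurableX 2 bA.
have bcst k : bounded_measurable (fun _ : Omega => k : R).
  exact: bounded_measurable_cst.
(* Centered average score times the leave-one-out coefficient, plus a deterministic bias from the
   change of coefficient. *)
have DA w : D n w = p * A w + (p - q) * m.
  by rewrite /D mean_mae_size_loo// -/p -(natr1 n) -/q /A; ring.
apply: (@le_trans _ _ (\int[P]_w (2 * p ^+ 2 * A w ^+ 2 + 2 * ((p - q) * m) ^+ 2))).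
  apply: mean_le; [exact: bounded_measurableX| |move=> w].
    by apply: bounded_measurableD => //; exact: bZ.
  rewrite DA; have := sqr_ge0 (p * A w - (p - q) * m); nra.
rewrite meanD ?meanZ ?mean_cst//; last exact: bZ.
have pB : p ^+ 2 <= 16 / alpha ^+ 2.
  have -> : 16 / alpha ^+ 2 = (4 / alpha) ^+ 2 by field; rewrite gt_eqF.
  by rewrite lerXn2r ?nnegrE// (le_trans c0).
(* The squared bias is of order [n^-2]; a factor [n] is given away to match the variance term. *)
have pqB : ((p - q) * m) ^+ 2 <= 16 / alpha ^+ 2 * Smax ^+ 2 / n%:R.
  have -> : 16 / alpha ^+ 2 * Smax ^+ 2 / n%:R = n%:R * (4 / alpha / n%:R * Smax) ^+ 2.
    by field; rewrite !gt_eqF// (lt_le_trans _ nR).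
  apply: (@le_trans _ _ ((4 / alpha / n%:R * Smax) ^+ 2)).
    have le_pqm : (p - q) * m <= 4 / alpha / n%:R * Smax by exact: ler_pM.
    have pqm0 : 0 <= (p - q) * m by exact: mulr_ge0.
    by rewrite lerXn2r ?nnegrE// (le_trans pqm0).
  by rewrite ler_peMl// sqr_ge0.
have AB := var n n0.
have : 2 * p ^+ 2 * \int[P]_w (A w ^+ 2) <= 2 * (16 / alpha ^+ 2) * (Smax ^+ 2 / n%:R).
  apply: ler_pM => //; first by rewrite mulr_ge0// sqr_ge0.
    by apply: Rintegral_ge0 => w _; exact: sqr_ge0.
  by rewrite ler_pM2l.
have -> : 64 * Smax ^+ 2 / alpha ^+ 2 / n%:R =
  2 * (16 / alpha ^+ 2) * (Smax ^+ 2 / n%:R) +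
  2 * (16 / alpha ^+ 2 * Smax ^+ 2 / n%:R).
  by field; rewrite !gt_eqF// (lt_le_trans _ nR).
lra.
Qed.

End Regression.

(** * Sigmoid estimates, and perturbed averages in the denominators *)

Section Sigmoid.
Context {R : realType}.

Lemma sigmoid_ge0 (x : R) : 0 <= sigmoid x.
Proof. by rewrite invr_ge0 addr_ge0// expR_ge0. Qed.

Lemma sigmoid_le1 (x : R) : sigmoid x <= 1.
Proof. by rewrite invf_le1 ?lerDl ?expR_ge0// ltr_pwDl// expR_ge0. Qed.

(** For [x <= y], with [u = expR (- x)] and [v = expR (- y)], the gap is
    [(u - v) / ((1 + u) * (1 + v))]. The bound [1 + t <= expR t] at [t = x - y] gives
    [u - v <= u * (y - x)], and [u] is below the denominator. *)
Lemma sigmoid_lipschitz (x y : R) : `|sigmoid x - sigmoid y| <= `|x - y|.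
Proof.
wlog xy : x y / x <= y.
  move=> H; have /orP[/H//|/H yx] := le_total x y.
  by rewrite distrC [leRHS]distrC.
have u0 := expR_gt0 (- x); have v0 := expR_gt0 (- y).
have vE : expR (- y) = expR (- x) * expR (x - y).
  by rewrite -expRD; congr expR; ring.
have uv : expR (- x) * (1 + (x - y)) <= expR (- y).
  by rewrite vE ler_pM2l// expR_ge1Dx.
have vu : expR (- y) <= expR (- x) by rewrite ler_expR lerN2.
have -> : sigmoid x - sigmoid y =
    (expR (- y) - expR (- x)) / ((1 + expR (- x)) * (1 + expR (- y))).
  by rewrite /sigmoid; field; rewrite !gt_eqF// ltr_pwDl// ltW.
set u := expR (- x) in u0 uv vu *; set v := expR (- y) in v0 uv vu *.
rewrite distrC (ger0_norm (_ : 0 <= y - x)) ?subr_ge0//.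
have d0 : 0 < (1 + u) * (1 + v) by rewrite mulr_gt0//; lra.
rewrite normrM normfV (gtr0_norm d0) ler_pdivrMr// ler0_norm ?subr_le0//.
nra.
Qed.

(** The two arguments differ by [k * s * (m - m') / (m * m')], and both denominators are at least
    [t]. *)
Lemma sigmoid_score_lipschitz (k a s b t m m' : R) :
  0 < k -> 0 <= s <= b -> 0 < t -> t <= m -> t <= m' ->
  `|sigmoid (k * (a - s / m)) - sigmoid (k * (a - s / m'))|
    <= k * b / t ^+ 2 * `|m - m'|.
Proof.
move=> k0 /andP[s0 sb] t0 tm tm'.
apply: (le_trans (sigmoid_lipschitz _ _)).
have m0 := lt_le_trans t0 tm; have m'0 := lt_le_trans t0 tm'.
have -> : k * (a - s / m) - k * (a - s / m') = k * s / (m * m') * (m - m').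
  by field; rewrite !gt_eqF.
rewrite normrM ler_wpM2r// ger0_norm; last first.
  by rewrite divr_ge0// mulr_ge0// ltW.
apply: ler_pM; [by rewrite mulr_ge0// ltW|by rewrite invr_ge0 mulr_ge0// ltW| |].
  by rewrite ler_pM2l.
by rewrite lef_pV2 ?posrE ?mulr_gt0 ?exprn_gt0// expr2 ler_pM// ltW.
Qed.

(** On positive reals the inverse is the power of exponent -1, which is measurable. *)
Lemma measurable_fun_inv_gt0 {d} {Omega : measurableType d} (X : Omega -> R) :
  measurable_fun [set: Omega] X -> (forall w, 0 < X w) ->
  measurable_fun [set: Omega] (fun w => (X w)^-1).
Proof.
move=> mX X0; rewrite (_ : (fun w => _) = @powR R ^~ (-1) \o X).
  by apply: measurableT_comp => //; exact: measurable_powR.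
by apply/funext => w /=; rewrite powR_inv1// ltW.
Qed.

Lemma measurable_sigmoid {d} {Omega : measurableType d} (X : Omega -> R) :
  measurable_fun [set: Omega] X ->
  measurable_fun [set: Omega] (fun w => sigmoid (X w)).
Proof.
move=> mX; apply: measurable_fun_inv_gt0 => [|w]; last by rewrite ltr_pwDl// expR_ge0.
apply: measurable_funD => //; apply: measurableT_comp; first exact: measurable_expR.
exact: measurableT_comp.
Qed.

Lemma measurable_sigmoid_score {d} {Omega : measurableType d} (k a : R)
    (s m : Omega -> R) :
  measurable_fun [set: Omega] s -> measurable_fun [set: Omega] m ->
  (forall w, 0 < m w) ->
  measurable_fun [set: Omega] (fun w => sigmoid (k * (a - s w / m w))).
Proof.
move=> ms mm m0; apply: measurable_sigmoid; apply: measurable_funM => //.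
apply: measurable_funB => //; apply: measurable_funM => //.
exact: measurable_fun_inv_gt0.
Qed.

Lemma sum_le_size (I : Type) (r : seq I) (F : I -> R) (c : R) :
  (forall y, F y <= c) -> \sum_(y <- r) F y <= (size r)%:R * c.
Proof.
move=> Fc; apply: le_trans (ler_sum _ (fun y _ => Fc y)) _.
by rewrite big_const_seq count_predT iter_addr_0 mulr_natl.
Qed.

Lemma sum_sigmoid_score_lipschitz (I : Type) (r : seq I) (k a b t mu delta : R)
    (s m : I -> R) :
  0 < k -> (forall y, 0 <= s y <= b) -> 0 < t -> t <= mu ->
  (forall y, t <= m y) -> (forall y, `|m y - mu| <= delta) ->
  `|\sum_(y <- r) sigmoid (k * (a - s y / m y)) -
    \sum_(y <- r) sigmoid (k * (a - s y / mu))|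
    <= (size r)%:R * (k * b / t ^+ 2) * delta.
Proof.
move=> k0 sb t0 tmu tm mdelta.
rewrite -sumrB (le_trans (ler_norm_sum _ _ _))//.
rewrite -mulrA; apply: sum_le_size => y.
apply: le_trans (sigmoid_score_lipschitz a k0 (sb y) t0 (tm y) tmu) _.
have /andP[s0 sb'] := sb y.
by rewrite ler_wpM2l// divr_ge0 ?sqr_ge0// (mulr_ge0 (ltW k0))// (le_trans s0).
Qed.

(** With [s] in the place of [U j] there are again [n] terms, so this is a true average of numbers
    above [a]. *)
Lemma leave_one_out_mean_ge (n : nat) (j : 'I_n) (U : nat -> R) (a s : R) :
  (forall i, a <= U i) -> a <= s ->
  a <= n%:R^-1 * (\sum_(i < n | i != j :> nat) U i + s).
Proof.
move=> aU as_; have n0 : (0 < n)%N := leq_ltn_trans (leq0n j) (ltn_ord j).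
rewrite mulrC ler_pdivlMr ?ltr0n// mulr_natr -{1}(card_ord n) -sumr_const.
by rewrite (bigD1 j)//= addrC lerD// ler_sum.
Qed.

Lemma leave_one_out_mean_dist (n : nat) (j : 'I_n) (U : nat -> R) (b s : R) :
  (forall i, 0 <= U i <= b) -> 0 <= s <= b ->
  `|n%:R^-1 * (\sum_(i < n | i != j :> nat) U i + s) -
    n%:R^-1 * \sum_(i < n) U i| <= b / n%:R.
Proof.
move=> Ub /andP[s0 sb]; rewrite sum_leave_one_out -mulrBr normrM.
rewrite ger0_norm ?invr_ge0// mulrC ler_wpM2r ?invr_ge0//.
have /andP[Uj0 Ujb] := Ub j.
set x := \sum_(i < n) _; have -> : x - U j + s - x = s - U j by ring.
by rewrite ler_norml; apply/andP; split; lra.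
Qed.

Lemma augmented_mean_ge (n : nat) (U : nat -> R) (a s : R) :
  (forall i, a <= U i) -> a <= s ->
  a <= n.+1%:R^-1 * (\sum_(i < n) U i + s).
Proof.
move=> aU as_; rewrite mulrC ler_pdivlMr ?ltr0n// mulr_natr mulrSr lerD//.
by rewrite -{1}(card_ord n) -sumr_const ler_sum.
Qed.

(** The difference is [s] minus the old average, divided by [n + 1]; both numbers lie between 0 and
    [b]. *)
Lemma augmented_mean_dist (n : nat) (U : nat -> R) (b s : R) : (0 < n)%N ->
  (forall i, 0 <= U i <= b) -> 0 <= s <= b ->
  `|n.+1%:R^-1 * (\sum_(i < n) U i + s) - n%:R^-1 * \sum_(i < n) U i|
    <= b / n%:R.
Proof.
move=> n0 Ub /andP[s0 sb].
set x := \sum_(i < n) _.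
have x0 : 0 <= x by apply: sumr_ge0 => i _; have /andP[] := Ub i.
have xb : x <= n%:R * b.
  rewrite mulr_natl -[in leRHS](card_ord n) -sumr_const; apply: ler_sum => i _.
  by have /andP[] := Ub i.
have nR : 0 < n%:R :> R by rewrite ltr0n.
have -> : n.+1%:R^-1 * (x + s) - n%:R^-1 * x = (s - x / n%:R) / (n%:R + 1).
  by rewrite -(natr1 n); field; rewrite !gt_eqF//; lra.
have xn : 0 <= x / n%:R <= b.
  by rewrite divr_ge0//= ler_pdivrMr// mulrC.
have b0 := le_trans s0 sb.
rewrite normrM normfV [X in _ / X]ger0_norm; last lra.
apply: ler_pM => //.
  by rewrite ler_norml; apply/andP; split; case/andP: xn; lra.
by rewrite lef_pV2 ?posrE//; lra.
Qed.

End Sigmoid.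

(** * Case (i): classification with sigmoid-smoothed sizes *)

Section Classification.
Context {R : realType} {d dX dY : measure_display} {Omega : measurableType d}
  {TX : measurableType dX} {TY : measurableType dY} (P : probability Omega R).

Lemma classification_OP (alpha : R)
    (Z : nat -> {RV P >-> (TX * TY)%type}) (Ztest : {RV P >-> (TX * TY)%type})
    (S : TX * TY -> R) (Smin Smax k : R) :
  iid_with_test Z Ztest ->
  measurable_fun [set: TX * TY] S ->
  finite_set [set: TY] ->
  0 < Smin -> Smin <= Smax ->
  (forall z, Smin <= S z <= Smax) ->
  0 < k ->
  OP_inv_sqrt P (fun n w =>
    `| (mean_loo_size (sigmoid_size_loo k alpha S Z) n w)%:E
       - 'E_P[sigmoid_size_test k alpha S Z Ztest n] |)%E.
Proof.
move=> iidZ mS finY Smin0 Sminmax Sb k0.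
(* An enumeration of the labels turns the finitely supported sums into sums over a sequence;
   [size r] is the number of labels. *)
pose r : seq TY := fset_set [set: TY].
have Sge z : Smin <= S z by have /andP[] := Sb z.
have Sle z : S z <= Smax by have /andP[] := Sb z.
have S0 z : 0 <= S z by rewrite (le_trans (ltW Smin0)).
have S0b z : 0 <= S z <= Smax by rewrite S0 Sle.
pose mu := \int[P]_w S (Ztest w).
have bSZ i := bounded_measurable_sample (Z := Z) mS S0 (fun i w => Sle (Z i w)) i.
have Smu : Smin <= mu.
  rewrite /mu -(iid_mean iidZ mS S0 0%N) -(mean_cst P Smin).
  by apply: mean_le => //; exact: bounded_measurable_cst.
pose g (z : TX * TY) : R :=
  \sum_(y <- r) sigmoid (k * (alpha^-1 - S (z.1, y) / mu)).
have mSy y (V : Omega -> TX * TY) : measurable_fun [set: Omega] V ->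
    measurable_fun [set: Omega] (fun w => S ((V w).1, y)).
  move=> mV; apply: (measurableT_comp (measurable_fun_pair1 y mS)).
  exact: measurableT_comp.
have mg : measurable_fun [set: TX * TY] g.
  apply: measurable_sum => y; apply: measurable_sigmoid_score => //.
    by apply: (measurableT_comp (measurable_fun_pair1 y mS)).
  by move=> _; exact: lt_le_trans Smu.
have g0 z : 0 <= g z by apply: sumr_ge0 => y _; exact: sigmoid_ge0.
have gN z : g z <= (size r)%:R.
  by rewrite -[leRHS]mulr1; apply: sum_le_size => y; exact: sigmoid_le1.
have bgZ i := bounded_measurable_sample (Z := Z) mg g0 (fun i w => gN (Z i w)) i.
pose nu := \int[P]_w g (Ztest w).
have bgtest : bounded_measurable (fun w => g (Ztest w)).
  split; first by apply: measurableT_comp => //; exact: measurable_funPT.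
  by exists (size r)%:R => w; rewrite ger0_norm.
(* Lipschitz constant of a whole smoothed size in its denominators, which all stay above [Smin]. *)
pose L : R := (size r)%:R * (k * Smax / Smin ^+ 2).
have L0 : 0 <= L.
  by rewrite mulr_ge0// divr_ge0 ?sqr_ge0// (mulr_ge0 (ltW k0))// (le_trans (ltW Smin0)).
pose A n w := n%:R^-1 * \sum_(i < n) S (Z i w) - mu.
pose B n w := n%:R^-1 * \sum_(i < n) g (Z i w) - nu.
have bA n : bounded_measurable (A n).
  apply: bounded_measurableB; last exact: bounded_measurable_cst.
  apply: bounded_measurableM; first exact: bounded_measurable_cst.
  exact: bounded_measurable_sum.
have bB n : bounded_measurable (B n).
  apply: bounded_measurableB; last exact: bounded_measurable_cst.
  apply: bounded_measurableM; first exact: bounded_measurable_cst.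
  exact: bounded_measurable_sum.
have varA n : (0 < n)%N -> \int[P]_w (A n w ^+ 2) <= Smax ^+ 2 / n%:R.
  exact: (iid_variance_average iidZ mS S0 (fun i w => Sle (Z i w))).
have varB n : (0 < n)%N -> \int[P]_w (B n w ^+ 2) <= (size r)%:R ^+ 2 / n%:R.
  exact: (iid_variance_average iidZ mg g0 (fun i w => gN (Z i w))).
pose loo n j w := sigmoid_size_loo k alpha S Z n j w.
pose test n w := sigmoid_size_test k alpha S Z Ztest n w.
pose m_loo n j y w := n%:R^-1 *
  (\sum_(i < n | i != j :> nat) S (Z i w) + S ((Z j w).1, y)).
pose m_test n y w := n.+1%:R^-1 * (\sum_(i < n) S (Z i w) + S ((Ztest w).1, y)).
have looE n j w : loo n j w = \sum_(y <- r)
    sigmoid (k * (alpha^-1 - S ((Z j w).1, y) / m_loo n j y w)).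
  by rewrite /loo /sigmoid_size_loo fsbig_finite.
have testE n w : test n w = \sum_(y <- r)
    sigmoid (k * (alpha^-1 - S ((Ztest w).1, y) / m_test n y w)).
  by rewrite /test /sigmoid_size_test fsbig_finite.
have m_looS n (j : 'I_n) y w : Smin <= m_loo n j y w.
  exact: (leave_one_out_mean_ge j (U := fun i => S (Z i w))).
have m_testS n y w : Smin <= m_test n y w.
  exact: (augmented_mean_ge n (U := fun i => S (Z i w))).
have mZ i : measurable_fun [set: Omega] (Z i) by exact: measurable_funPT.
have mZt : measurable_fun [set: Omega] Ztest by exact: measurable_funPT.
have mSZ i : measurable_fun [set: Omega] (fun w => S (Z i w)) by have [] := bSZ i.
have bounded_sum (F : TY -> Omega -> R) :
    (forall y, measurable_fun [set: Omega] (fun w => sigmoid (F y w))) ->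
    bounded_measurable (fun w => \sum_(y <- r) sigmoid (F y w)).
  move=> mF; apply: bounded_measurable_sum => y; split => //.
  by exists 1 => w; rewrite ger0_norm ?sigmoid_ge0// sigmoid_le1.
have bloo n (j : 'I_n) : bounded_measurable (loo n j).
  rewrite (funext (looE n j)).
  apply: bounded_sum => y; apply: measurable_sigmoid_score; first exact: mSy.
    apply: measurable_funM => //; apply: measurable_funD; last exact: mSy.
    under eq_fun do rewrite (sum_leave_one_out (fun i => S (Z i _))).
    by apply: measurable_funB => //; exact: measurable_sum.
  by move=> w; exact: lt_le_trans (m_looS n j y w).
have btest n : bounded_measurable (test n).
  rewrite (funext (testE n)).
  apply: bounded_sum => y; apply: measurable_sigmoid_score; first exact: mSy.
    apply: measurable_funM => //; apply: measurable_funD; last exact: mSy.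
    exact: measurable_sum.
  by move=> w; exact: lt_le_trans (m_testS n y w).
pose D n w := mean_loo_size (sigmoid_size_loo k alpha S Z) n w - \int[P]_w test n w.
have bcst c : bounded_measurable (fun _ : Omega => c : R).
  exact: bounded_measurable_cst.
have bD n : bounded_measurable (D n).
  apply: bounded_measurableB => //; apply: bounded_measurableM => //.
  by apply: bounded_measurable_sum => j; exact: bloo.
rewrite (_ : (fun n w => _) = fun n w => `|(D n w)%:E|%E); last first.
  by apply/funext => n; apply/funext => w; rewrite expectation_Rintegral.
(* The 4 is the cost of squaring a sum of four terms. The 6 is 1 + 1 + 4, from [L * |A n w|], its
   mean [L * a], and [2 * L * c]; the last summand is the variance bound for [B n]. *)
apply: (@OP_inv_sqrt_mean_sqr _ _ _ P D
  (4 * (6 * L ^+ 2 * Smax ^+ 2 + (size r)%:R ^+ 2)) 1) => [n|n n0].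
  by have [] := bD n.
split => //.
have nR : 1 <= n%:R :> R by rewrite ler1n.
have nR0 : 0 < n%:R :> R by exact: lt_le_trans nR.
pose c := Smax / n%:R.
pose a := \int[P]_w `|A n w|.
(* Triangle inequality through the sample average of the scores: any denominator within [c] of it is
   this close to [mu]. *)
have le_delta w x : `|x - n%:R^-1 * \sum_(i < n) S (Z i w)| <= c ->
    `|x - mu| <= `|A n w| + c.
  move=> xc; rewrite [leRHS]addrC.
  rewrite (le_trans (ler_distD (n%:R^-1 * \sum_(i < n) S (Z i w)) _ _))//.
  exact: lerD.
have looB (j : 'I_n) w : `|loo n j w - g (Z j w)| <= L * (`|A n w| + c).
  rewrite looE; apply: sum_sigmoid_score_lipschitz => // y.
  apply: le_delta.
  exact: (leave_one_out_mean_dist j (U := fun i => S (Z i w))).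
have testB w : `|test n w - g (Ztest w)| <= L * (`|A n w| + c).
  rewrite testE; apply: sum_sigmoid_score_lipschitz => // y.
  apply: le_delta.
  exact: (augmented_mean_dist n0 (U := fun i => S (Z i w))).
have meanlooB w : `|mean_loo_size (sigmoid_size_loo k alpha S Z) n w - (B n w + nu)|
    <= L * (`|A n w| + c).
  rewrite /B subrK /mean_loo_size -mulrBr -sumrB normrM ger0_norm ?invr_ge0//.
  rewrite mulrC ler_pdivrMr// mulrC -[n in n%:R * _](card_ord n).
  rewrite mulr_natl -sumr_const (le_trans (ler_norm_sum _ _ _))//.
  by apply: ler_sum => j _; exact: looB.
have bnA := bounded_measurable_norm (bA n).
(* Integrated form of [testB], which turns [|A n w|] into its mean [a]. *)
have ELB : `|\int[P]_w test n w - nu| <= L * (a + c).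
  rewrite -meanB//.
  apply: le_trans (le_normr_Rintegral measurableT _) _.
    by apply: bounded_measurable_integrable; exact: bounded_measurableB.
  rewrite -[X in _ <= L * (a + X)](mean_cst P) -meanD// -meanZ; last exact: bounded_measurableD.
  apply: mean_le => //.
    by apply: bounded_measurable_norm; exact: bounded_measurableB.
  by apply: bounded_measurableM => //; exact: bounded_measurableD.
have c0 : 0 <= c by rewrite divr_ge0// (le_trans (ltW Smin0)).
have a0 : 0 <= a by apply: Rintegral_ge0.
have a2 : a ^+ 2 <= Smax ^+ 2 / n%:R.
  apply: le_trans (varA n n0); apply: le_trans (sqr_mean_le P bnA) _.
  by rewrite (_ : \int[P]_w _ = \int[P]_w (A n w ^+ 2))//;
    apply: eq_Rintegral => w _; rewrite real_normK// num_real.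
have c2 : c ^+ 2 <= Smax ^+ 2 / n%:R.
  rewrite /c expr_div_n ler_wpM2l ?sqr_ge0// lef_pV2 ?posrE ?exprn_gt0//.
  by rewrite expr2 ler_peMr// ltW.
have DB w : D n w ^+ 2 <=
    4 * L ^+ 2 * A n w ^+ 2 + (4 * B n w ^+ 2 + 4 * L ^+ 2 * (a ^+ 2 + 4 * c ^+ 2)).
  have DB1 : `|D n w| <= L * `|A n w| + `|B n w| + L * a + 2 * L * c.
    (* Three errors: leave-one-out sizes against [g], the fluctuation of the average of [g], and the
       bias of the expected test size. The first and third each contribute [L * c]. *)
    have -> : D n w =
      (mean_loo_size (sigmoid_size_loo k alpha S Z) n w - (B n w + nu)) +
      B n w - (\int[P]_w test n w - nu) by rewrite /D; ring.
    apply: le_trans (ler_normB _ _) _; apply: le_trans (lerD (ler_normD _ _) (lexx _)) _.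
    have := meanlooB w; lra.
  rewrite -(real_normK (num_real (A n w))) -(real_normK (num_real (B n w))).
  rewrite -(real_normK (num_real (D n w))).
  have [A0 B0] := (normr_ge0 (A n w), normr_ge0 (B n w)).
  set p := L * `|A n w| in DB1; set q := L * a in DB1.
  have -> : 4 * L ^+ 2 * `|A n w| ^+ 2 + (4 * `|B n w| ^+ 2 +
      4 * L ^+ 2 * (a ^+ 2 + 4 * c ^+ 2)) =
      4 * (p ^+ 2 + `|B n w| ^+ 2 + q ^+ 2 + (2 * L * c) ^+ 2).
    by rewrite /p /q; ring.
  apply: (@le_trans _ _ ((p + `|B n w| + q + 2 * L * c) ^+ 2)).
    by rewrite lerXn2r ?nnegrE// (le_trans _ DB1).
  move: (`|B n w|) (2 * L * c) => x y.
  (* Four times the sum of four squares minus the square of the sum is the sum of the six squared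
     pairwise differences. *)
  have := sqr_ge0 (p - x); have := sqr_ge0 (p - q); have := sqr_ge0 (p - y).
  have := sqr_ge0 (x - q); have := sqr_ge0 (x - y); have := sqr_ge0 (q - y).
  lra.
have bA2 := bounded_measurableX 2 (bA n).
have bB2 := bounded_measurableX 2 (bB n).
have bZ u X : bounded_measurable X -> bounded_measurable (fun w : Omega => u * X w : R).
  exact: bounded_measurableM.
apply: le_trans (mean_le P (bounded_measurableX 2 (bD n)) _ DB) _.
  by do 2 (apply: bounded_measurableD; auto).
rewrite meanD; [|by auto|by apply: bounded_measurableD; auto].
rewrite meanD; [|by auto|by auto].
rewrite !meanZ// mean_cst.
have L2 := sqr_ge0 L.
have -> : 4 * (6 * L ^+ 2 * Smax ^+ 2 + (size r)%:R ^+ 2) / n%:R =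
  4 * L ^+ 2 * (Smax ^+ 2 / n%:R) + (4 * ((size r)%:R ^+ 2 / n%:R) +
  4 * L ^+ 2 * (Smax ^+ 2 / n%:R + 4 * (Smax ^+ 2 / n%:R))).
  by field; rewrite gt_eqF.
have L42 : 0 <= 4 * L ^+ 2 by rewrite mulr_ge0.
rewrite lerD ?ler_wpM2l ?varA// lerD ?ler_wpM2l ?varB// lerD// ler_pM2l//.
Qed.

End Classification.

Theorem theorem2p6 (R : realType) (d dX : measure_display)
    (Omega : measurableType d) (P : probability Omega R)
    (TX : measurableType dX) (alpha : R) (halpha : 0 < alpha < 1) :
  (* (i) classification, sigmoid smoothing *)
  (forall (dY : measure_display) (TY : measurableType dY)
     (Z : nat -> {RV P >-> (TX * TY)%type}) (Ztest : {RV P >-> (TX * TY)%type})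
     (S : TX * TY -> R) (Smin Smax k : R),
     iid_with_test Z Ztest ->
     measurable_fun [set: TX * TY] S ->
     finite_set [set: TY] ->
     0 < Smin -> Smin <= Smax ->
     (forall z, Smin <= S z <= Smax) ->
     (\forall n \near \oo, Smax / Smin < n%:R) ->
     0 < k ->
     OP_inv_sqrt P (fun n w =>
       `| (mean_loo_size (sigmoid_size_loo k alpha S Z) n w)%:E
          - 'E_P[sigmoid_size_test k alpha S Z Ztest n] |)%E)
  /\
  (* (ii) regression, MAE score; the label space is the subset Y of R *)
  (forall (Y : set R)
     (Z : nat -> {RV P >-> (TX * measurableTypeR R)%type})
     (Ztest : {RV P >-> (TX * measurableTypeR R)%type})
     (f : TX -> R) (Smax : R),
     iid_with_test Z Ztest ->
     (forall i w, Y (Z i w).2) -> (forall w, Y (Ztest w).2) ->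
     measurable_fun [set: TX] f ->
     (forall x y, Y y -> 0 <= mae_score f (x, y) <= Smax) ->
     (\forall n \near \oo, n%:R^-1 < alpha) ->
     OP_inv_sqrt P (fun n w =>
       `| (mean_loo_size (mae_size_loo alpha (mae_score f) Z) n w)%:E
          - 'E_P[mae_size_test alpha (mae_score f) Z n] |)%E).
Proof.
split.
  move=> dY TY Z Ztest S Smin Smax k iidZ mS finY Smin0 Sminmax Sb _ k0.
  exact: (classification_OP alpha iidZ mS finY Smin0 Sminmax Sb k0).
move=> Y Z Ztest f Smax iidZ YZ _ mf fY _.
exact: (regression_OP halpha iidZ YZ mf fY).
Qed.
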